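(* Let $A\in\mathbb{R}^{n\times n}$, $B\in\mathbb{R}^{n\times m}$, $C\in\mathbb{R}^{m\times n}$, $D\in\mathbb{R}^{m\times m}$, and let $P,S\in\mathbb{R}^{n\times n}$ satisfy $S^\top P=P^\top S$, $\operatorname{rank}\begin{bmatrix}P\\S\end{bmatrix}=n$, and the generalized dissipation inequality $$\begin{bmatrix} S^\top AP+P^\top A^\top S & S^\top B-P^\top C^\top\\ B^\top S-CP & -D-D^\top\end{bmatrix}\le 0,$$ so that there exist matrices $M,N$ with $$(\ast)\qquad \begin{bmatrix} S^\top AP+P^\top A^\top S & S^\top B-P^\top C^\top\\ B^\top S-CP & -D-D^\top\end{bmatrix}=-\begin{bmatrix}M^\top\\N^\top\end{bmatrix}\begin{bmatrix}M&N\end{bmatrix}.$$ Consider the generalized transfer matrix $$G(s):=CP(Ps-AP)^{-}B+D$$ of the differential-algebraic system $P\dot z=APz+Bu$, $y=CPz+Du$. Then $(\ast)$ corresponds to the following factorization of transfer matrices: $$G(s)+G^\top(-s)=K^\top(-s)K(s),\qquad\text{where}\quad K(s):=M(Ps-AP)^{-}B+N .$$ (Here $\ker P\subset\ker M$, so that $K(s)$, like $G(s)$, is well defined.)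
   Context: For a symmetric real matrix $X$, $X\le 0$ means negative semidefinite. For a matrix function $T$, $T^-$ denotes an appropriate generalized inverse; it is used because $Ps-AP$ is singular when $P$ is singular. The expression $P(Ps-AP)^-B$ is regarded as well defined because the generalized dissipation inequality implies that $\operatorname{im}B$ is contained in $\operatorname{im}P$, and because the generalized inverse is premultiplied by $P$. $G^\top(-s)$ denotes the transpose of $G(-s)$, and similarly for $K^\top(-s)$. *)

(* Defs.v *)
From mathcomp Require Import all_boot all_order all_algebra.
From mathcomp Require Import generic_quotient.
From mathcomp Require Import reals.

Set Implicit Arguments.
Unset Strict Implicit.
Unset Printing Implicit Defensive.

Import Order.TTheory GRing.Theory Num.Theory.
Local Open Scope ring_scope.
Local Open Scope quotient_scope.

Definition neg_semidef (R : realType) (k : nat) (X : 'M[R]_k) : Prop :=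
  X^T = X /\ forall v : 'cV[R]_k, (v^T *m X *m v) 0 0 <= 0.

(* Transfer matrices have entries in the field R(s), whose indeterminate s is
   the image of 'X. *)
Notation ratfun R := {fraction {poly R}}.

Definition svar (R : realType) : ratfun R := tofrac 'X.

Definition cst_mx (R : realType) (p q : nat) (T : 'M[R]_(p, q)) :
    'M[ratfun R]_(p, q) :=
  map_mx (fun c : R => tofrac c%:P) T.

(* The substitution s |-> -s; [subst_neg_frac] shows that it does not depend on
   the representative of the fraction. *)
Definition subst_neg (R : realType) (f : ratfun R) : ratfun R :=
  tofrac (\n_(repr f) \Po - 'X) / tofrac (\d_(repr f) \Po - 'X).

Definition subst_neg_mx (R : realType) (p q : nat) (T : 'M[ratfun R]_(p, q)) :
    'M[ratfun R]_(p, q) :=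
  map_mx (@subst_neg R) T.

Lemma comp_negX_eq0 (R : realType) (q : {poly R}) :
  (q \Po - 'X == 0) = (q == 0).
Proof.
apply/idP/idP => [/eqP h|/eqP ->]; last by rewrite comp_poly0.
have: (q \Po - 'X) \Po - 'X = 0 by rewrite h comp_poly0.
have -> : (q \Po - 'X) \Po - 'X = q.
  rewrite -comp_polyA.
  have -> : (- 'X : {poly R}) \Po - 'X = 'X.
    by rewrite rmorphN /= comp_polyX opprK.
  by rewrite comp_polyXr.
by move=> ->.
Qed.

Lemma ratfun_repr (R : realType) (f : ratfun R) :
  f = tofrac \n_(repr f) / tofrac \d_(repr f).
Proof.
rewrite -[LHS](reprK f); move: (repr f) => x.
have d0 := denom_ratioP x; have n1 := oner_neq0 {poly R}.
rewrite -[RHS]/(FracField.mul _ (FracField.inv _)); unlock tofrac.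
rewrite -FracField.pi_inv -FracField.pi_mul.
apply/eqmodP; rewrite /= FracField.equivfE /FracField.mulf /FracField.invf.
by rewrite !(numden_Ratio, mul1r, mulr1) // mulrC.
Qed.

Lemma subst_neg_frac (R : realType) (p q : {poly R}) : q != 0 ->
  subst_neg (tofrac p / tofrac q) =
  tofrac (p \Po - 'X) / tofrac (q \Po - 'X).
Proof.
move=> q0; rewrite /subst_neg.
set f := tofrac p / tofrac q.
have d0 := denom_ratioP (repr f).
have E : tofrac p / tofrac q = tofrac \n_(repr f) / tofrac \d_(repr f).
  exact: ratfun_repr.
move: E => /eqP; rewrite eqr_div ?tofrac_eq0 // -!tofracM tofrac_eq => /eqP E.
apply/eqP; rewrite eqr_div ?tofrac_eq0 ?comp_negX_eq0 // -!tofracM tofrac_eq.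
by rewrite -!rmorphM /= -E.
Qed.

Definition gen_inverse (F : fieldType) (p q : nat)
    (T : 'M[F]_(p, q)) (X : 'M[F]_(q, p)) : Prop :=
  T *m X *m T = T.

Lemma gen_inverse_pinvmx (F : fieldType) (p q : nat) (T : 'M[F]_(p, q)) :
  gen_inverse T (pinvmx T).
Proof. by rewrite /gen_inverse mulmxKpV. Qed.

Definition dae_pencil (R : realType) (n : nat) (A P : 'M[R]_n) :
    'M[ratfun R]_n :=
  svar R *: cst_mx P - cst_mx (A *m P).

(* In [transfer_G] and [transfer_K], X stands for the generalized inverse
   (Ps - AP)^-. *)
Definition transfer_G (R : realType) (n m : nat) (B : 'M[R]_(n, m))
    (C : 'M[R]_(m, n)) (D : 'M[R]_m) (P : 'M[R]_n) (X : 'M[ratfun R]_n) :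
    'M[ratfun R]_m :=
  cst_mx (C *m P) *m X *m cst_mx B + cst_mx D.

Definition transfer_K (R : realType) (n m k : nat) (B : 'M[R]_(n, m))
    (M : 'M[R]_(k, n)) (N : 'M[R]_(k, m)) (X : 'M[ratfun R]_n) :
    'M[ratfun R]_(k, m) :=
  cst_mx M *m X *m cst_mx B + cst_mx N.

Definition gdi_mx (R : realType) (n m : nat) (A : 'M[R]_n) (B : 'M[R]_(n, m))
    (C : 'M[R]_(m, n)) (D : 'M[R]_m) (P S : 'M[R]_n) : 'M[R]_(n + m) :=
  block_mx (S^T *m A *m P + P^T *m A^T *m S) (S^T *m B - P^T *m C^T)
           (B^T *m S - C *m P)               (- D - D^T).

Definition gdi_factor (R : realType) (n m k : nat) (A : 'M[R]_n)
    (B : 'M[R]_(n, m)) (C : 'M[R]_(m, n)) (D : 'M[R]_m) (P S : 'M[R]_n)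
    (M : 'M[R]_(k, n)) (N : 'M[R]_(k, m)) : Prop :=
  gdi_mx A B C D P S = - (col_mx M^T N^T *m row_mx M N).

(* Main.v *)
Require Import Defs.
From HB Require Import structures.
From mathcomp Require Import all_boot all_order all_algebra.
From mathcomp Require Import reals ring.

Set Implicit Arguments.
Unset Strict Implicit.

Import Order.TTheory GRing.Theory Num.Theory.
Local Open Scope ring_scope.

(** Since [col_mx P S] spans a Lagrangian subspace, every v with v^T P = 0 is
    S x for some x with P x = 0; the factorization gives M x = 0, hence
    v^T B = 0 and v^T A P = 0. So B = P B' and A P = P A', and the pencil
    T = P s - A P equals both (s - A) P and P (s - A') with invertible factors
    s - A and s - A'. Therefore T Z = B has a solution Z, while P and M are left
    multiples of T, so that C P T^- B = C P Z and M T^- B = M Z for every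
    generalized inverse T^-. Substituting A P Z = s P Z - B and its image under
    s |-> -s into K(-s)^T K(s), the terms in s cancel because S^T P = P^T S. *)

(** * Factorization through kernels, Lagrangian subspaces and Gram matrices *)

Lemma gram_eq0 (R : realDomainType) (p q : nat) (Z : 'M[R]_(p, q)) :
  Z^T *m Z = 0 -> Z = 0.
Proof.
move=> h; apply/matrixP => i j; rewrite [RHS]mxE.
have := congr1 (fun W : 'M[R]_q => W j j) h; rewrite !mxE.
move=> /eqP; rewrite psumr_eq0 => [|k _]; last by rewrite mxE -expr2 sqr_ge0.
by move=> /allP /(_ i (mem_index_enum i)); rewrite /= mxE mulf_eq0 orbb => /eqP.
Qed.

(** The rows of [(cokermx P^T)^T] annihilate [P], so by hypothesis they annihilate [B], which puts
    the column space of [B] inside that of [P]. *)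
Lemma cokernel_factor (F : fieldType) (n p q : nat)
    (P : 'M[F]_(n, p)) (B : 'M[F]_(n, q)) :
  (forall (r : nat) (V : 'M[F]_(r, n)), V *m P = 0 -> V *m B = 0) ->
  exists B', B = P *m B'.
Proof.
move=> h.
have hV : B^T *m cokermx P^T = 0.
  apply: trmx_inj; rewrite trmx_mul trmxK trmx0; apply: h.
  by apply: trmx_inj; rewrite trmx_mul trmxK mulmx_coker trmx0.
have /submxP[W hW] : (B^T <= P^T)%MS by rewrite submxE hV.
by exists W^T; apply: trmx_inj; rewrite trmx_mul trmxK.
Qed.

Lemma kernel_factor (F : fieldType) (n p q : nat)
    (P : 'M[F]_(p, n)) (M : 'M[F]_(q, n)) :
  (forall (r : nat) (V : 'M[F]_(n, r)), P *m V = 0 -> M *m V = 0) ->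
  exists M', M = M' *m P.
Proof.
move=> h; have [r V|W hW] := @cokernel_factor F n p q P^T M^T.
  move=> hV; apply: trmx_inj; rewrite trmx_mul trmxK trmx0 h //.
  by apply: trmx_inj; rewrite trmx_mul trmxK hV trmx0.
by exists W^T; apply: trmx_inj; rewrite trmx_mul trmxK.
Qed.

(* The image of [col_mx P S] is isotropic of dimension n, hence Lagrangian:
   it contains every vector (0, v) orthogonal to it. *)
Lemma lagrangian_cokernel (F : fieldType) (n q : nat) (P S : 'M[F]_n)
    (V : 'M[F]_(q, n)) :
  S^T *m P = P^T *m S -> \rank (col_mx P S) = n -> V *m P = 0 ->
  exists2 Y : 'M[F]_(n, q), P *m Y = 0 & V = (S *m Y)^T.
Proof.
move=> hsym hrank hV.
(* The rows of [W] span the Lagrangian subspace and [L] is its image under the symplectic form, so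
   isotropy reads [W *m L^T = 0]. *)
pose W := row_mx P^T S^T; pose L := row_mx S^T (- P^T).
have hW : row_free W by rewrite /row_free /W -tr_col_mx mxrank_tr hrank.
have hL : row_free L.
  rewrite -kermx_eq0; set U := kermx L.
  have : U *m L = 0 by exact: mulmx_ker.
  rewrite mul_mx_row -[X in _ = X]row_mx0 => /eq_row_mx[h1 h2].
  apply/eqP/(row_free_inj hW).
  rewrite mul0mx mul_mx_row h1 -[RHS]row_mx0; congr row_mx.
  by apply: oppr_inj; rewrite -mulmxN h2 oppr0.
have hWL : (W <= kermx L^T)%MS.
  apply/sub_kermxP.
  by rewrite tr_row_mx mul_row_col linearN /= !trmxK mulmxN hsym subrr.
(* The dimension 2n - n = n is also that of [W], so the inclusion [hWL] is an equality. *)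
have hrk : \rank (kermx L^T) = n.
  by rewrite mxrank_ker mxrank_tr (eqP hL) addnK.
have hVL : (row_mx 0 V <= kermx L^T)%MS.
  apply/sub_kermxP.
  by rewrite tr_row_mx mul_row_col linearN /= !trmxK mul0mx mulmxN hV subr0.
have hLW : (kermx L^T <= W)%MS.
  by have := mxrank_leqif_sup hWL; rewrite hrk (eqP hW) => -[_ <-].
have /submxP[Y] := submx_trans hVL hLW.
rewrite mul_mx_row => /eq_row_mx[h1 h2].
exists Y^T; first by apply: trmx_inj; rewrite trmx_mul trmxK -h1 trmx0.
by rewrite trmx_mul trmxK.
Qed.

(** Block Cholesky factorization by induction on the size: split off the corner entry [a] and pass
    to the Schur complement [E - r^T *m r], where [r] is b / sqrt a. *)
Lemma psd_gram (R : rcfType) (n : nat) (X : 'M[R]_n) :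
  X^T = X -> (forall v : 'cV[R]_n, 0 <= (v^T *m X *m v) 0 0) ->
  exists Q : 'M[R]_n, X = Q^T *m Q.
Proof.
elim: n X => [|n IHn] X symX psdX.
  by exists 0; rewrite flatmx0 [RHS]flatmx0.
move: X symX psdX; rewrite -[n.+1]/(1 + n)%N => X symX psdX.
pose a := X 0 0; pose b := ursubmx X; pose E := drsubmx X.
have hX : X = block_mx a%:M b b^T E.
  rewrite -[LHS]submxK -/b -/E; congr block_mx.
    by rewrite [LHS]mx11_scalar !mxE !lshift0.
  by rewrite /b trmx_ursub symX.
have symE : E^T = E by rewrite /E trmx_drsub symX.
have formX (t : R) (w : 'cV[R]_n) :
    0 <= a * t ^+ 2 + t * (b *m w) 0 0 *+ 2 + (w^T *m E *m w) 0 0.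
  have := psdX (col_mx t%:M w).
  rewrite hX tr_col_mx mul_row_block mul_row_col tr_scalar_mx !mulmxDl.
  rewrite !mul_scalar_mx -!scalemxAl !mul_scalar_mx.
  have -> : w^T *m b^T *m t%:M = t *: (b *m w).
    rewrite mul_mx_scalar -trmx_mul; congr (_ *: _).
    by rewrite [b *m w]mx11_scalar tr_scalar_mx.
  rewrite !mxE !mulr1n => h.
  by rewrite (le_trans h) // le_eqVlt; apply/orP; left; apply/eqP; ring.
have a_ge0 : 0 <= a.
  by have := formX 1 0; rewrite !mulmx0 !mxE mulr0 mul0rn !addr0 expr1n mulr1.
(* For a zero pivot the form at w = b^T is affine in t with slope 2 |b|^2; if b were nonzero, the
   chosen t would give it the value -1. *)
have b0 : a = 0 -> b = 0.
  move=> a0; apply: trmx_inj; rewrite trmx0; apply: gram_eq0; rewrite trmxK.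
  set w := b^T; set c := (b *m w) 0 0; set e := (w^T *m E *m w) 0 0.
  rewrite [b *m w]mx11_scalar -/c; suff -> : c = 0 by rewrite raddf0.
  apply/eqP/negPn/negP => c0; have := formX (- (e + 1) / (c * 2)) w.
  rewrite a0 mul0r add0r -/c -/e.
  have -> : - (e + 1) / (c * 2) * c *+ 2 + e = - 1 by field; rewrite c0.
  by rewrite ler0N1.
(* If [a = 0], the inverse is 0 by convention and [r = 0]; [hb] then still holds by [b0]. *)
pose r := (Num.sqrt a)^-1 *: b.
have hb : b = Num.sqrt a *: r.
  have [a0|a0] := eqVneq a 0; first by rewrite /r a0 sqrtr0 scale0r b0.
  by rewrite scalerA divff ?scale1r // sqrtr_eq0 -ltNge lt_def a0.
have [|w|Q hQ] := IHn (E - r^T *m r).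
- by rewrite linearB /= trmx_mul trmxK symE.
- set u := (r *m w) 0 0.
  have hu : (w^T *m (E - r^T *m r) *m w) 0 0 = (w^T *m E *m w) 0 0 - u ^+ 2.
    rewrite mulmxBr mulmxBl mxE [in X in _ + X]mxE; congr (_ - _).
    rewrite mulmxA -mulmxA -trmx_mul [r *m w]mx11_scalar -/u.
    by rewrite tr_scalar_mx mul_scalar_mx !mxE mulr1n.
  (* This t minimizes the form for fixed w, and the minimum is the form of the Schur complement at
     w. *)
  rewrite hu; pose t := - (Num.sqrt a)^-1 * u.
  have ht : Num.sqrt a * t = - u.
    have [a0|a0] := eqVneq a 0.
      by rewrite /t /u /r a0 sqrtr0 mul0r invr0 scale0r mul0mx mxE oppr0.
    by rewrite /t mulrA mulrN divff ?mulN1r // sqrtr_eq0 -ltNge lt_def a0.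
  have hbw : (b *m w) 0 0 = Num.sqrt a * u by rewrite hb -scalemxAl mxE.
  have hat : a * t ^+ 2 = u ^+ 2.
    by rewrite -[RHS]sqrrN -ht [RHS]exprMn sqr_sqrtr.
  have htu : t * (Num.sqrt a * u) = - u ^+ 2 by rewrite mulrCA mulrA ht mulNr.
  have := formX t w; rewrite hbw hat htu => h.
  by rewrite (le_trans h) // le_eqVlt; apply/orP; left; apply/eqP; ring.
exists (block_mx (Num.sqrt a)%:M r 0 Q).
rewrite tr_block_mx mulmx_block hX tr_scalar_mx !trmx0 !mul0mx !mulmx0 !addr0.
rewrite -scalar_mxM -expr2 sqr_sqrtr // mul_scalar_mx mul_mx_scalar -hQ.
have hbT : b^T = Num.sqrt a *: r^T by rewrite hb linearZ.
by rewrite -hb -hbT [in RHS]addrC subrK.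
Qed.

(** * The substitution s |-> -s as a ring morphism of R(s) *)

Lemma subst_neg_tofrac (R : realType) (p : {poly R}) :
  subst_neg (tofrac p) = tofrac (p \Po - 'X).
Proof.
have := subst_neg_frac p (oner_neq0 {poly R}).
by rewrite comp_polyC tofrac1 !divr1.
Qed.

Lemma ratfun_fracP (R : realType) (f : ratfun R) :
  exists p q : {poly R}, q != 0 /\ f = tofrac p / tofrac q.
Proof.
do 2 eexists; split; last exact: ratfun_repr.
exact: denom_ratioP.
Qed.

Lemma subst_neg_is_zmod_morphism (R : realType) : zmod_morphism (@subst_neg R).
Proof.
move=> f g; have [p [q [q0 ->]]] := ratfun_fracP f.
have [p' [q' [q'0 ->]]] := ratfun_fracP g.
rewrite -mulNr addf_div ?tofrac_eq0 // -tofracN -!tofracM -tofracD.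
rewrite !subst_neg_frac ?mulf_neq0 // -mulNr.
rewrite addf_div ?tofrac_eq0 ?comp_negX_eq0 //.
by rewrite -tofracN -!tofracM -tofracD !(rmorphD, rmorphM, rmorphN).
Qed.

Lemma subst_neg_is_monoid_morphism (R : realType) :
  monoid_morphism (@subst_neg R).
Proof.
split=> [|f g]; first by rewrite -tofrac1 subst_neg_tofrac comp_polyC.
have [p [q [q0 ->]]] := ratfun_fracP f.
have [p' [q' [q'0 ->]]] := ratfun_fracP g.
rewrite mulf_div -!tofracM !subst_neg_frac ?mulf_neq0 //.
by rewrite mulf_div -!tofracM !rmorphM.
Qed.

HB.instance Definition _ (R : realType) :=
  GRing.isZmodMorphism.Build (ratfun R) (ratfun R) (@subst_neg R)
    (@subst_neg_is_zmod_morphism R).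
HB.instance Definition _ (R : realType) :=
  GRing.isMonoidMorphism.Build (ratfun R) (ratfun R) (@subst_neg R)
    (@subst_neg_is_monoid_morphism R).

Lemma subst_neg_svar (R : realType) : subst_neg (svar R) = - svar R.
Proof. by rewrite /svar subst_neg_tofrac comp_polyX tofracN. Qed.

Lemma subst_neg_cst_mx (R : realType) (p q : nat) (T : 'M[R]_(p, q)) :
  subst_neg_mx (cst_mx T) = cst_mx T.
Proof.
by apply/matrixP => i j; rewrite !mxE subst_neg_tofrac comp_polyC.
Qed.

(** * Constant matrices and resolvents over R(s) *)

Lemma cst_mxE (R : realType) (p q : nat) (T : 'M[R]_(p, q)) :
  cst_mx T = map_mx (@tofrac {poly R} \o polyC) T.
Proof. by []. Qed.

Lemma cst_mxM (R : realType) (p q r : nat) (T : 'M[R]_(p, q))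
    (U : 'M[R]_(q, r)) :
  cst_mx (T *m U) = cst_mx T *m cst_mx U.
Proof. by rewrite !cst_mxE map_mxM. Qed.

Lemma cst_mxD (R : realType) (p q : nat) (T U : 'M[R]_(p, q)) :
  cst_mx (T + U) = cst_mx T + cst_mx U.
Proof. by rewrite !cst_mxE map_mxD. Qed.

Lemma cst_mxN (R : realType) (p q : nat) (T : 'M[R]_(p, q)) :
  cst_mx (- T) = - cst_mx T.
Proof. by rewrite !cst_mxE map_mxN. Qed.

Lemma cst_mx_tr (R : realType) (p q : nat) (T : 'M[R]_(p, q)) :
  cst_mx T^T = (cst_mx T)^T.
Proof. by rewrite /cst_mx map_trmx. Qed.

(** This is the image in R(s) of the characteristic matrix of [A], whose determinant is monic and
    hence nonzero. *)
Lemma resolvent_unit (R : realType) (n : nat) (A : 'M[R]_n) :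
  (svar R)%:M - cst_mx A \in unitmx.
Proof.
have -> : (svar R)%:M - cst_mx A = map_mx (@tofrac {poly R}) (char_poly_mx A).
  rewrite map_mxB /= map_scalar_mx; congr (_ - _).
  by apply/matrixP => i j; rewrite !mxE.
rewrite unitmxE unitfE det_map_mx tofrac_eq0.
exact/monic_neq0/char_poly_monic.
Qed.

(* With T the pencil and [M = V *m T], [B = T *m Z], the product [M *m X *m B]
   is [V *m T *m X *m T *m Z = M *m Z], whatever the generalized inverse X. *)
Lemma gen_inverse_mul (F : fieldType) (n p q : nat) (T X : 'M[F]_n)
    (M V : 'M[F]_(p, n)) (B Z : 'M[F]_(n, q)) :
  gen_inverse T X -> M = V *m T -> T *m Z = B -> M *m X *m B = M *m Z.
Proof.
by move=> hX -> <-; rewrite mulmxA -!(mulmxA V) hX.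
Qed.

(** A purely algebraic identity: [Z'] stands for Z(-s), and the substitution shows only in the sign
    of [s] in the last two hypotheses. *)
Lemma dissipation_spectral_factor (F : fieldType) (n m k : nat) (s : F)
    (A : 'M[F]_n) (B : 'M[F]_(n, m)) (C : 'M[F]_(m, n)) (D : 'M[F]_m)
    (P S : 'M[F]_n) (M : 'M[F]_(k, n)) (N : 'M[F]_(k, m))
    (Z Z' : 'M[F]_(n, m)) :
  S^T *m P = P^T *m S ->
  M^T *m M = - (S^T *m A *m P + P^T *m A^T *m S) ->
  M^T *m N = P^T *m C^T - S^T *m B ->
  N^T *m M = C *m P - B^T *m S ->
  N^T *m N = D + D^T ->
  A *m P *m Z = s *: (P *m Z) - B ->
  A *m P *m Z' = - s *: (P *m Z') - B ->
  C *m P *m Z + D + (C *m P *m Z' + D)^T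
    = (M *m Z' + N)^T *m (M *m Z + N).
Proof.
move=> hsym hMM hMN hNM hNN hZ hZ'.
have hZ't : Z'^T *m (P^T *m A^T) = - s *: (Z'^T *m P^T) - B^T.
  by rewrite -!trmx_mul hZ' linearB linearZ.
(* Only in this product does [s] appear; its two terms cancel by [hsym]. *)
have hMMZ : Z'^T *m M^T *m (M *m Z)
    = Z'^T *m S^T *m B + B^T *m S *m Z.
  rewrite mulmxA -(mulmxA Z'^T) hMM mulmxN mulNmx mulmxDr mulmxDl.
  have -> : Z'^T *m (S^T *m A *m P) *m Z
      = s *: (Z'^T *m (S^T *m P) *m Z) - Z'^T *m S^T *m B.
    rewrite -!mulmxA (mulmxA A) hZ !mulmxBr -!scalemxAr; congr (_ - _).
  have -> : Z'^T *m (P^T *m A^T *m S) *m Z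
      = - (s *: (Z'^T *m (P^T *m S) *m Z)) - B^T *m S *m Z.
    by rewrite mulmxA hZ't !mulmxBl -!scalemxAl scaleNr !mulmxA.
  by rewrite hsym addrACA subrr add0r opprD !opprK.
rewrite [(M *m Z' + N)^T]linearD /= trmx_mul mulmxDl !mulmxDr hMMZ.
have -> : Z'^T *m M^T *m N = Z'^T *m P^T *m C^T - Z'^T *m S^T *m B.
  by rewrite -mulmxA hMN mulmxBr !mulmxA.
rewrite (mulmxA N^T) hNM hNN mulmxBl linearD /= !trmx_mul !mulmxA.
by apply/matrixP => i j; rewrite !mxE; ring.
Qed.

(** * Consequences of the factorized dissipation inequality *)

Section Factor.

Variables (R : realType) (n m k : nat).
Variables (A : 'M[R]_n) (B : 'M[R]_(n, m)) (C : 'M[R]_(m, n)) (D : 'M[R]_m).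
Variables (P S : 'M[R]_n) (M : 'M[R]_(k, n)) (N : 'M[R]_(k, m)).

Lemma gdi_factorP :
  gdi_factor A B C D P S M N ->
  [/\ M^T *m M = - (S^T *m A *m P + P^T *m A^T *m S),
      M^T *m N = P^T *m C^T - S^T *m B,
      N^T *m M = C *m P - B^T *m S
    & N^T *m N = D + D^T].
Proof.
rewrite /gdi_factor /gdi_mx mul_col_row opp_block_mx.
move=> /eq_block_mx[-> hMN hNM hNN]; split.
- by rewrite opprK.
- by apply: oppr_inj; rewrite -hMN opprB.
- by apply: oppr_inj; rewrite -hNM opprB.
- by apply: oppr_inj; rewrite -hNN opprD.
Qed.

Hypothesis hfac : gdi_factor A B C D P S M N.

(** In the Gram matrix of [M *m Y], expanded by the (1,1) block, each term contains [P *m Y] or its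
    transpose. *)
Lemma factor_ker (q : nat) (Y : 'M[R]_(n, q)) : P *m Y = 0 -> M *m Y = 0.
Proof.
have [hMM _ _ _] := gdi_factorP hfac => hY.
apply: gram_eq0; rewrite trmx_mul -mulmxA (mulmxA M^T) hMM mulNmx mulmxN.
rewrite mulmxDl mulmxDr -!mulmxA hY !mulmx0 add0r.
by rewrite (mulmxA Y^T) -trmx_mul hY trmx0 mul0mx oppr0.
Qed.

Hypothesis hsym : S^T *m P = P^T *m S.
Hypothesis hrank : \rank (col_mx P S) = n.

(** A left null vector of [P] is [(S *m Y)^T] with [P *m Y = 0], and B^T S Y = C P Y - N^T M Y
    vanishes because [M *m Y = 0] as well. *)
Lemma factor_input : exists B', B = P *m B'.
Proof.
apply: cokernel_factor => r V hV.
have [Y hY ->] := lagrangian_cokernel hsym hrank hV.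
have [_ _ hNM _] := gdi_factorP hfac.
have hBS : B^T *m S = C *m P - N^T *m M by rewrite hNM opprB addrC subrK.
apply: trmx_inj; rewrite trmx_mul trmxK trmx0 mulmxA hBS mulmxBl -!mulmxA.
by rewrite hY factor_ker // !mulmx0 subrr.
Qed.

(** The same argument with the (1,1) block: P^T A^T S Y = - M^T M Y - S^T A P Y = 0. *)
Lemma factor_invariant : exists A', A *m P = P *m A'.
Proof.
apply: cokernel_factor => r V hV.
have [Y hY ->] := lagrangian_cokernel hsym hrank hV.
have [hMM _ _ _] := gdi_factorP hfac.
have hSAP : P^T *m A^T *m S = - (M^T *m M) - S^T *m A *m P.
  by rewrite hMM opprK addrC addKr.
apply: trmx_inj; rewrite trmx_mul trmxK trmx0 trmx_mul mulmxA hSAP mulmxBl.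
by rewrite mulNmx -!mulmxA hY factor_ker // !mulmx0 subr0 oppr0.
Qed.

Lemma dae_pencil_left :
  dae_pencil A P = ((svar R)%:M - cst_mx A) *m cst_mx P.
Proof. by rewrite mulmxBl mul_scalar_mx /dae_pencil cst_mxM. Qed.

Lemma factor_solution : exists Z, dae_pencil A P *m Z = cst_mx B.
Proof.
have [B' hB] := factor_input; have [A' hA] := factor_invariant.
(* The pencil equals P (s - A'), so it sends this witness to P B' = B. *)
exists (invmx ((svar R)%:M - cst_mx A') *m cst_mx B').
have -> : dae_pencil A P = cst_mx P *m ((svar R)%:M - cst_mx A').
  by rewrite mulmxBr mul_mx_scalar /dae_pencil hA cst_mxM.
by rewrite -mulmxA mulKVmx ?resolvent_unit // -cst_mxM -hB.
Qed.

Lemma factor_left_pencil (q : nat) (W : 'M[R]_(q, n)) :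
  exists V, cst_mx (W *m P) = V *m dae_pencil A P.
Proof.
exists (cst_mx W *m invmx ((svar R)%:M - cst_mx A)).
by rewrite dae_pencil_left -mulmxA mulKmx ?resolvent_unit // cst_mxM.
Qed.

Lemma transfer_solution (X : 'M[ratfun R]_n) (Z : 'M[ratfun R]_(n, m)) :
  gen_inverse (dae_pencil A P) X -> dae_pencil A P *m Z = cst_mx B ->
  transfer_G B C D P X = cst_mx (C *m P) *m Z + cst_mx D /\
  transfer_K B M N X = cst_mx M *m Z + cst_mx N.
Proof.
move=> hX hZ; rewrite /transfer_G /transfer_K.
have [M' hM] := kernel_factor factor_ker.
have [V hV] := factor_left_pencil C; have [V' hV'] := factor_left_pencil M'.
rewrite hM (gen_inverse_mul hX hV hZ).
by rewrite (gen_inverse_mul hX hV' hZ).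
Qed.

Lemma subst_neg_solution (Z : 'M[ratfun R]_(n, m)) :
  dae_pencil A P *m Z = cst_mx B ->
  (- svar R *: cst_mx P - cst_mx (A *m P)) *m subst_neg_mx Z = cst_mx B.
Proof.
move=> hZ; rewrite -[RHS]subst_neg_cst_mx -hZ /subst_neg_mx map_mxM.
congr (_ *m _); rewrite map_mxB map_mxZ /= subst_neg_svar.
by rewrite -!/(subst_neg_mx _) !subst_neg_cst_mx.
Qed.

Lemma transfer_factorization (X : 'M[ratfun R]_n) :
  gen_inverse (dae_pencil A P) X ->
  transfer_G B C D P X + (subst_neg_mx (transfer_G B C D P X))^T =
  (subst_neg_mx (transfer_K B M N X))^T *m transfer_K B M N X.
Proof.
move=> hX; have [Z hZ] := factor_solution.
have [-> ->] := transfer_solution hX hZ.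
have hZ' := subst_neg_solution hZ.
have [hMM hMN hNM hNN] := gdi_factorP hfac.
(* Constant matrices are fixed by s |-> -s, so G(-s) and K(-s) are the same affine expressions in
   Z(-s). *)
have sub_affine (q : nat) (W : 'M[R]_(q, n)) (U : 'M[R]_(q, m)) :
    subst_neg_mx (cst_mx W *m Z + cst_mx U)
      = cst_mx W *m subst_neg_mx Z + cst_mx U.
  rewrite /subst_neg_mx map_mxD map_mxM -!/(subst_neg_mx _).
  by rewrite !subst_neg_cst_mx.
rewrite !sub_affine cst_mxM.
apply: (@dissipation_spectral_factor _ _ _ _ (svar R) (cst_mx A) (cst_mx B)
  _ _ _ (cst_mx S)).
- by rewrite -!cst_mx_tr -!cst_mxM hsym.
- by rewrite -!cst_mx_tr -!cst_mxM hMM cst_mxN cst_mxD.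
- by rewrite -!cst_mx_tr -!cst_mxM hMN cst_mxD cst_mxN.
- by rewrite -!cst_mx_tr -!cst_mxM hNM cst_mxD cst_mxN.
- by rewrite -!cst_mx_tr -!cst_mxM hNN cst_mxD.
- by rewrite -hZ /dae_pencil mulmxBl -scalemxAl -cst_mxM subKr.
- by rewrite -hZ' mulmxBl -scalemxAl -cst_mxM subKr.
Qed.

End Factor.

Unset Implicit Arguments.

Theorem propositionV1 (R : realType) (n m : nat)
    (A : 'M[R]_n) (B : 'M[R]_(n, m)) (C : 'M[R]_(m, n)) (D : 'M[R]_m)
    (P S : 'M[R]_n)
    (hsym : S^T *m P = P^T *m S)
    (hrank : \rank (col_mx P S) = n)
    (hgdi : neg_semidef (gdi_mx A B C D P S)) :
  (exists (k : nat) (M : 'M[R]_(k, n)) (N : 'M[R]_(k, m)),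
      gdi_factor A B C D P S M N)
  /\
  (forall (k : nat) (M : 'M[R]_(k, n)) (N : 'M[R]_(k, m)),
    gdi_factor A B C D P S M N ->
    [/\ forall x : 'cV[R]_n, P *m x = 0 -> M *m x = 0,
        forall X Y : 'M[ratfun R]_n,
          gen_inverse (dae_pencil A P) X -> gen_inverse (dae_pencil A P) Y ->
          transfer_G B C D P X = transfer_G B C D P Y /\
          transfer_K B M N X = transfer_K B M N Y
      & forall X : 'M[ratfun R]_n, gen_inverse (dae_pencil A P) X ->
          transfer_G B C D P X + (subst_neg_mx (transfer_G B C D P X))^T =
          (subst_neg_mx (transfer_K B M N X))^T *m transfer_K B M N X]).
Proof.
split.
  have [symX nsdX] := hgdi.
  (* The column blocks of a Gram factor [Q] of the negated matrix serve as [M] and [N], hence k = n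
     + m. *)
  have [||Q hQ] := @psd_gram R _ (- gdi_mx A B C D P S).
  - by rewrite linearN /= symX.
  - by move=> v; rewrite mulmxN mulNmx mxE oppr_ge0.
  exists (n + m)%N, (lsubmx Q), (rsubmx Q).
  by rewrite /gdi_factor -tr_row_mx hsubmxK -hQ opprK.
move=> k M N hfac; split.
- exact: factor_ker hfac 1%N.
(* Both choices of generalized inverse reduce to the same expressions in [Z]. *)
- move=> X Y hX hY; have [Z hZ] := factor_solution hfac hsym hrank.
  have [-> ->] := transfer_solution hfac hX hZ.
  by have [-> ->] := transfer_solution hfac hY hZ.
- by move=> X hX; rewrite (transfer_factorization hfac hsym hrank hX).
Qed.
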